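(* Let $K$ be a field of characteristic zero, and let $A\subseteq K[x_1,\ldots,x_d]$ be a principal Borel-fixed algebra with Borel generator $m=x_{i_1}^{a_{i_1}}\cdots x_{i_r}^{a_{i_r}}$, where $i_1<i_2<\cdots<i_r=d$ and $a_{i_j}>0$ for $j=1,\ldots,r$. Then the Gauss algebra $\mathbb{G}(A)$ is principal Borel-fixed with Borel generator $$m'=\frac{m^{i_r}}{x_{i_1}^{i_1-1}\,x_{i_2}^{i_2-i_1}\cdots x_{i_{r-1}}^{i_{r-1}-i_{r-2}}\,x_{i_r}^{i_r-i_{r-1}+1}},$$ i.e. the set of monomial generators $(g_1\cdots g_d)/(x_1\cdots x_d)$ of $\mathbb{G}(A)$ (with $g_1,\ldots,g_d\in\langle m\rangle$ and $\det(\mathrm{Log}(g_1,\ldots,g_d))\ne 0$) equals the Borel set $\langle m'\rangle$. (For $r=1$ the denominator is read as $x_{i_1}^{i_1}$.)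
   Context: Borel sets: a finite set $G$ of monomials of the same degree in $S=K[x_1,\ldots,x_d]$ is a Borel set if the monomial ideal generated by $G$ is fixed under all linear automorphisms of $S$ given by nonsingular upper triangular matrices; since $\mathrm{char}(K)=0$, this is equivalent to: for every $u\in G$ and all $i<j$ such that $x_j$ divides $u$, one has $x_i(u/x_j)\in G$. For monomials $u_1,\ldots,u_t$ of the same degree, $\langle u_1,\ldots,u_t\rangle$ denotes the smallest Borel set containing them; they are called Borel generators of it. A Borel set is principal if it is of the form $\langle u\rangle$ for a single monomial $u$. Borel-fixed algebra: for a Borel set $G\subset S$, the $K$-subalgebra $A=K[G]$ of $S$ is a Borel-fixed algebra if $\dim A=d$ (equivalently, $x_d$ divides some element of $G$); it is principal, with Borel generator $m$, if $G=\langle m\rangle$. In particular the largest index of a variable dividing $m$ is $d$. Log-matrix: $\mathrm{Log}(g_1,\ldots,g_n)$ is the matrix whose columns are the exponent vectors of the monomials $g_1,\ldots,g_n$. Gauss algebra: if $A=K[g_1,\ldots,g_n]\subseteq S$ is generated by homogeneous polynomials of the same degree and $\dim A=d$, then $\mathbb{G}(A)$ is the $K$-subalgebra of $S$ generated by the $d\times d$ minors of the Jacobian matrix of $g_1,\ldots,g_n$. If the $g_i$ are monomials, then $\mathbb{G}(A)$ is generated by the monomials $(g_{i_1}\cdots g_{i_d})/(x_1\cdots x_d)$ with $\det(\mathrm{Log}(g_{i_1},\ldots,g_{i_d}))\neq 0$.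
   Formalization: The requirement dim G(A) = d in ''principal Borel-fixed'' is claimed only when x_d divides m'; it fails for m = x_d (m' = 1) and m = x_1^a x_d with d ≥ 2 (m' = x_1^{ad}); the equality of the monomial generators with ⟨m'⟩ is claimed in all cases. *)

(* Defs.v *)
From HB Require Import structures.
From mathcomp Require Import all_boot all_order all_algebra.
From mathcomp Require Import finmap mpoly.

Set Implicit Arguments.
Unset Strict Implicit.
Unset Printing Implicit Defensive.

Import Order.TTheory GRing.Theory Num.Theory.

Local Open Scope fset_scope.
Local Open Scope ring_scope.

(* Variables are indexed from 0: 'X_j with j : 'I_d stands for x_(j+1). *)

Section BorelSets.

Variables (K : fieldType) (d : nat).
Local Notation S := {mpoly K[d]}.

Definition monomial_ideal (G : {fset 'X_{1..d}}) (p : S) : Prop :=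
  exists c : 'X_{1..d} -> S, p = \sum_(u <- G) c u * 'X_[u].

(* The substitution x_j |-> \sum_i T_ij x_i. *)
Definition linear_subst (T : 'M[K]_d) (p : S) : S :=
  p \mPo [tuple \sum_i T i j *: 'X_i | j < d].

(* [is_trig_mx] means lower triangular, hence the transpose: T_ij = 0 for
   j < i, and x_j is sent to a combination of x_i with i <= j. *)
Definition borel_fixed_ideal (I : S -> Prop) : Prop :=
  forall T : 'M[K]_d, T \in unitmx -> is_trig_mx T^T ->
  forall q : S, I q <-> exists2 p : S, I p & q = linear_subst T p.

Definition borel_set (G : {fset 'X_{1..d}}) : Prop :=
  {in G &, forall u v : 'X_{1..d}, mdeg u = mdeg v} /\
  borel_fixed_ideal (monomial_ideal G).

Definition borel_generated (us G : {fset 'X_{1..d}}) : Prop :=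
  [/\ borel_set G, us `<=` G
    & forall H : {fset 'X_{1..d}}, borel_set H -> us `<=` H -> G `<=` H].

End BorelSets.

Section Algebras.

Variables (K : fieldType) (d : nat).
Local Notation S := {mpoly K[d]}.

Inductive gen_algebra (X : S -> Prop) : S -> Prop :=
| gen_algebra_gen p of X p : gen_algebra X p
| gen_algebra_const c : gen_algebra X c%:MP
| gen_algebra_add p q of gen_algebra X p & gen_algebra X q :
    gen_algebra X (p + q)
| gen_algebra_mul p q of gen_algebra X p & gen_algebra X q :
    gen_algebra X (p * q).

Definition monomial_algebra (G : {fset 'X_{1..d}}) : S -> Prop :=
  gen_algebra (fun p => exists2 u, u \in G & p = 'X_[u]).

(* Stability under opposites follows from that under multiplication by A when
   A is a K-subalgebra. *)
Definition prime_ideal_of (A P : S -> Prop) : Prop :=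
  [/\ forall p, P p -> A p,
      P 0 /\ forall p q, P p -> P q -> P (p + q),
      forall a p, A a -> P p -> P (a * p),
      ~ P 1
    & forall p q, A p -> A q -> P (p * q) -> P p \/ P q].

Definition prime_chain (A : S -> Prop) (n : nat) : Prop :=
  exists P : nat -> S -> Prop,
    (forall k, (k <= n)%N -> prime_ideal_of A (P k)) /\
    (forall k, (k < n)%N ->
       (forall p, P k p -> P k.+1 p) /\ exists2 p, P k.+1 p & ~ P k p).

Definition krull_dim (A : S -> Prop) (n : nat) : Prop :=
  prime_chain A n /\ forall k, prime_chain A k -> (k <= n)%N.

Definition principal_borel_fixed (m : 'X_{1..d}) (G : {fset 'X_{1..d}})
    (A : S -> Prop) : Prop :=
  [/\ borel_generated K [fset m] G,
      forall p, A p <-> monomial_algebra G p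
    & krull_dim A d].

Definition jacobian_mx (g : seq S) : 'M[S]_(size g, d) :=
  \matrix_(k, j) (g`_k)^`M(j).

Definition gauss_algebra (g : seq S) : S -> Prop :=
  gen_algebra (fun p => exists2 f : 'I_d -> 'I_(size g),
    {homo f : k l / (k < l)%N} & p = \det (rowsub f (jacobian_mx g))).

Definition monomials (G : {fset 'X_{1..d}}) : seq S :=
  [seq 'X_[u] | u <- enum_fset G].

End Algebras.

Section Exponents.

Variable d : nat.

Definition log_mx n (g : n.-tuple 'X_{1..d}) : 'M[int]_(d, n) :=
  \matrix_(i, j) (tnth g j i)%:Z.

(* u = (g_1 ... g_d) / (x_1 ... x_d), cleared of its denominator. *)
Definition gauss_monomial (G : {fset 'X_{1..d}}) (u : 'X_{1..d}) : Prop :=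
  exists g : d.-tuple 'X_{1..d},
    [/\ {subset g <= G}, \det (log_mx g) != 0
      & (u + [multinom 1%N | _ < d] = \sum_(v <- g) v)%MM].

Definition borel_gen r (i : 'I_r.+1 -> 'I_d) (a : 'I_r.+1 -> nat) :
    'X_{1..d} :=
  (\sum_(j < r.+1) U_(i j) *+ a j)%MM.

(* With 1-based indices, the exponent of x_(i_j) in the denominator of m' is
   i_j - i_(j-1), increased by one for the last j, where i_0 := 1. Hence the
   value 0 below for the 0-based index preceding the first one. *)
Definition prev_index r (i : 'I_r.+1 -> 'I_d) (j : 'I_r.+1) : nat :=
  if (j : nat) is k.+1 then i (inord k) else 0%N.

Definition gauss_denom r (i : 'I_r.+1 -> 'I_d) : 'X_{1..d} :=
  (\sum_(j < r.+1)
     U_(i j) *+ (i j - prev_index i j + (j == ord_max))%N)%MM.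

(* [mnm_sub] is truncated: this is a genuine quotient of monomials when
   gauss_denom i divides the d-th power of borel_gen i a. *)
Definition gauss_gen r (i : 'I_r.+1 -> 'I_d) (a : 'I_r.+1 -> nat) :
    'X_{1..d} :=
  (borel_gen i a *+ d - gauss_denom i)%MM.

End Exponents.

(* Main.v *)
Require Import Defs.
From HB Require Import structures.
From mathcomp Require Import all_boot all_order all_algebra all_fingroup.
From mathcomp Require Import finmap mpoly.
From mathcomp Require Import zify.

(* A Borel set <m> consists of the monomials u of the same degree as m whose
   tails u_k + u_(k+1) + ... are bounded by those of m; it is the only set that
   can satisfy the definition because, in characteristic 0, Borel sets are closed
   under u |-> x_a u / x_b for a < b (substitute x_b + x_a for x_b).

   Bounding the tails of Gauss monomials by those of m': among d linearly
   independent exponent vectors below m, those with the same k-th tail as m lie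
   in a subspace whose codimension is k minus the largest i_j < k (indices being
   counted from 0).
   Conversely, Gauss monomials are again closed under u |-> x_a u / x_b, by a
   multilinearity argument on the determinant, and m' is one of them.

   In characteristic 0 a maximal minor of the Jacobian matrix of monomials is
   det(Log) times the corresponding Gauss monomial, up to sign, so both algebras
   agree. The dimension is computed by the chain of primes contracted from
   (x_(d-k+1), ..., x_d), and bounded by the algebraic dependence of any d + 1
   polynomials. *)

Set Implicit Arguments.
Unset Strict Implicit.
Unset Printing Implicit Defensive.

Import Order.TTheory GRing.Theory Num.Theory.

Local Open Scope fset_scope.
Local Open Scope ring_scope.

(** * The Borel order *)
Section BorelOrder.

Variable d : nat.
Implicit Types (u v w m : 'X_{1..d}) (G H : {fset 'X_{1..d}}).

Definition tail k u : nat := (\sum_(l < d | k <= l) u l)%N.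

Definition borel_le u w : bool :=
  (mdeg u == mdeg w) && [forall k : 'I_d, tail k u <= tail k w]%N.

Definition strongly_stable (P : 'X_{1..d} -> Prop) : Prop :=
  forall u (a b : 'I_d), P u -> (a < b)%N -> (0 < u b)%N ->
  P (u - U_(b) + U_(a))%MM.

(** The monomials of degree at most [mdeg m] form the finite ambient type from which [borel_le]
    selects. *)
Definition borel_closure m : {fset 'X_{1..d}} :=
  [fset v in [seq val x | x : 'X_{1..d < (mdeg m).+1}] | borel_le v m].

Lemma in_borel_closure m u : (u \in borel_closure m) = borel_le u m.
Proof.
rewrite /borel_closure !inE /= andb_idl // => /andP[/eqP deg_u _].
have lt_u : (mdeg u < (mdeg m).+1)%N by rewrite deg_u.
by apply/mapP; exists (BMultinom lt_u); rewrite ?mem_enum.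
Qed.

Lemma tail0 u : tail 0 u = mdeg u.
Proof. by rewrite mdegE /tail; apply: eq_bigl. Qed.

Lemma tail_ge u k : (d <= k)%N -> tail k u = 0%N.
Proof.
move=> le_dk; rewrite /tail big1 // => l le_kl.
by have := leq_trans le_dk le_kl; rewrite leqNgt ltn_ord.
Qed.

Lemma tailD k u v : tail k (u + v)%MM = (tail k u + tail k v)%N.
Proof. by rewrite /tail -big_split; apply: eq_bigr => l _; rewrite mnmDE. Qed.

Lemma tail1 k (a : 'I_d) : tail k U_(a)%MM = (k <= a)%N.
Proof.
rewrite /tail; under eq_bigr do rewrite mnm1E.
case: leqP => ka.
  rewrite (bigD1 a) //= eqxx big1 // => l /andP[_ /negPf].
  by rewrite eq_sym => ->.
rewrite big1 // => l kl; case: eqP => // al.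
by rewrite al ltnNge kl in ka.
Qed.

Lemma tail_sum k (I : Type) (s : seq I) P (F : I -> 'X_{1..d}) :
  tail k (\sum_(x <- s | P x) F x)%MM = (\sum_(x <- s | P x) tail k (F x))%N.
Proof.
elim/big_rec2: _ => [|x n u _ <-]; last by rewrite tailD.
by rewrite /tail big1 // => l _; rewrite mnm0E.
Qed.

Lemma tailMn k u n : tail k (u *+ n)%MM = (tail k u * n)%N.
Proof.
by rewrite /tail big_distrl; apply: eq_bigr => l _; rewrite mulmnE.
Qed.

Lemma tailS u (k : 'I_d) : tail k u = (u k + tail k.+1 u)%N.
Proof.
rewrite /tail (bigD1 k) //=; congr addn; apply: eq_bigl => l.
by rewrite ltn_neqAle andbC eq_sym.
Qed.

Lemma leq_tail u k l : (k <= l)%N -> (tail l u <= tail k u)%N.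
Proof.
move=> le_kl; rewrite /tail big_mkcond [leqRHS]big_mkcond /= leq_sum // => x _.
by case: (leqP l) => // lx; rewrite (leq_trans le_kl lx).
Qed.

Lemma mnm_swap u (a b : 'I_d) : (0 < u b)%N ->
  (u - U_(b) + U_(a) + U_(b) = u + U_(a))%MM.
Proof.
move=> ub; rewrite -!addmA [(U_(a) + _)%MM]addmC addmA submK //.
by rewrite lep1mP -lt0n.
Qed.

Lemma mdeg_swap u (a b : 'I_d) : (0 < u b)%N ->
  mdeg (u - U_(b) + U_(a))%MM = mdeg u.
Proof.
move=> ub; apply/(@addIn 1%N).
by rewrite -[in LHS](mdeg1 b) -mdegD mnm_swap // mdegD mdeg1.
Qed.

Lemma tail_swap u (a b : 'I_d) k : (0 < u b)%N ->
  (tail k (u - U_(b) + U_(a))%MM + (k <= b) = tail k u + (k <= a))%N.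
Proof. by move=> ub; rewrite -[in LHS]tail1 -tailD mnm_swap // tailD tail1. Qed.

Lemma borel_leP u w :
  reflect (mdeg u = mdeg w /\ forall k, (tail k u <= tail k w)%N) (borel_le u w).
Proof.
apply: (iffP andP) => [[/eqP deg /forallP le]|[-> le]]; last first.
  by split=> //; apply/forallP => k.
split=> // k; case: (ltnP k d) => kd; first exact: (le (Ordinal kd)).
by rewrite tail_ge.
Qed.

Lemma borel_le_refl u : borel_le u u.
Proof. by apply/borel_leP. Qed.

Lemma borel_le_trans v u w : borel_le u v -> borel_le v w -> borel_le u w.
Proof.
move=> /borel_leP[du tu] /borel_leP[dv tv]; apply/borel_leP.
by split=> [|k]; [rewrite du | apply: leq_trans (tv k)].
Qed.

Lemma borel_leD u v u' v' :
  borel_le u u' -> borel_le v v' -> borel_le (u + v)%MM (u' + v')%MM.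
Proof.
move=> /borel_leP[du tu] /borel_leP[dv tv]; apply/borel_leP.
by split=> [|k]; rewrite ?mdegD ?du ?dv // !tailD leq_add.
Qed.

Lemma borel_le1 (a b : 'I_d) : (a <= b)%N -> borel_le U_(a)%MM U_(b)%MM.
Proof.
move=> ab; apply/borel_leP; split=> [|k]; first by rewrite !mdeg1.
by rewrite !tail1; case: (leqP k a) => // ka; rewrite (leq_trans ka ab).
Qed.

Lemma borel_le_swap u (a b : 'I_d) :
  (a < b)%N -> (0 < u b)%N -> borel_le (u - U_(b) + U_(a))%MM u.
Proof.
move=> ab ub; apply/borel_leP; split=> [|k]; first exact: mdeg_swap.
by have := tail_swap a k ub; case: leqP; case: leqP; lia.
Qed.

Lemma strongly_stable_closure m : strongly_stable (fun u => u \in borel_closure m).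
Proof.
move=> u a b; rewrite !in_borel_closure => um ab ub.
exact: borel_le_trans (borel_le_swap ab ub) um.
Qed.

(* Raising the first tail of u that is not yet equal to that of w moves one unit
   from some x_(k-1) to x_k, and produces a monomial still below w. *)
Lemma strongly_stable_le (P : 'X_{1..d} -> Prop) u w :
  strongly_stable P -> P w -> borel_le u w -> P u.
Proof.
(* Induction on the total gap between the tails of [u] and those of [w]. *)
move=> stP wP; have [n] := ubnP (\sum_(k < d) (tail k w - tail k u))%N.
elim: n u => // n IHn u /ltnSE le_n /borel_leP[deg le].
case: (pickP (fun k : 'I_d => tail k u < tail k w)%N) => [k0 lt0|eq_t]; last first.
  suff -> : u = w by [].
  apply/mnmP => l; have t_eq k : tail k u = tail k w.
    case: (ltnP k d) => kd; last by rewrite !tail_ge.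
    by have := eq_t (Ordinal kd); have := le k => /=; lia.
  by have := tailS u l; rewrite !t_eq tailS; lia.
have [k lt_k min_k] :=
  @arg_minnP _ _ (fun k : 'I_d => (tail k u < tail k w)%N) val lt0.
have k_gt0 : (0 < k)%N.
  by rewrite lt0n; apply: contraTneq lt_k => ->; rewrite !tail0 deg ltnn.
have lt_pd : (k.-1 < d)%N by have := ltn_ord k; lia.
pose p := Ordinal lt_pd.
have eq_p : tail p u = tail p w.
  apply/eqP; rewrite eqn_leq le /= leqNgt; apply/negP => lt.
  by have /= := min_k p lt; lia.
have pK : p.+1 = k by rewrite /= prednK.
(* The tails of [u] and [w] agree at [p] but that of [u] is smaller at [k = p + 1], so [u p] exceeds
   [w p]. *)
have up : (0 < u p)%N.
  have := tailS u p; have := tailS w p; rewrite eq_p pK; lia.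
pose v := (u - U_(p) + U_(k))%MM.
have tv l : tail l v = (tail l u + (l == k))%N.
  by have := tail_swap k l up; rewrite -/v -pK /=; lia.
have vp : (0 < v k)%N by rewrite /v mnmDE mnm1E eqxx addn1.
have -> : u = (v - U_(k) + U_(p))%MM.
  by rewrite /v addmK submK // lep1mP -lt0n.
apply: stP; rewrite //= ?prednK //; apply: IHn.
  apply: leq_trans le_n; rewrite [ltnRHS](bigD1 k) //= [ltnLHS](bigD1 k) //=.
  rewrite -addSn leq_add //; first by rewrite tv eqxx; lia.
  by apply: leq_sum => l _; rewrite tv; lia.
apply/borel_leP; split=> [|l]; first by rewrite mdeg_swap.
rewrite tv; case: eqP => [->|_]; first by rewrite addn1.
by rewrite addn0.
Qed.

End BorelOrder.

(** * Borel sets in characteristic zero *)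
Section BorelSets.

Variables (K : fieldType) (d : nat).
Implicit Types (u v w m : 'X_{1..d}) (G H : {fset 'X_{1..d}}).
Implicit Types (p q : {mpoly K[d]}) (T : 'M[K]_d).

Lemma monomial_ideal0 G : @monomial_ideal K d G 0.
Proof. by exists (fun=> 0); rewrite big1 // => u _; rewrite mul0r. Qed.

Lemma monomial_idealD G p q :
  monomial_ideal G p -> monomial_ideal G q -> monomial_ideal G (p + q).
Proof.
move=> [c ->] [c' ->]; exists (fun u => c u + c' u).
by rewrite -big_split; apply: eq_bigr => u _; rewrite mulrDl.
Qed.

Lemma monomial_idealX G c u v :
  u \in G -> (u <= v)%MM -> @monomial_ideal K d G (c *: 'X_[v]).
Proof.
move=> uG uv; exists (fun w => if w == u then c *: 'X_[v - u] else 0).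
rewrite (bigD1_seq u) ?fset_uniq //= eqxx big1 ?addr0.
  by rewrite -scalerAl -mpolyXD submK.
by move=> w /negPf->; rewrite mul0r.
Qed.

Lemma monomial_idealP G p :
  monomial_ideal G p <->
  {in msupp p, forall v, exists2 u, u \in G & (u <= v)%MM}.
Proof.
split=> [[c ->] v /msupp_sum_le /flattenP[s /mapP[u]]|suppG].
  rewrite mem_filter /= => uG ->; rewrite (perm_mem (msuppMX _ _)).
  by case/mapP => w _ ->; exists u => //; rewrite lem_addr.
rewrite [p]mpolyE big_seq; elim/big_ind: _ => [||v /suppG[u uG uv]].
- exact: monomial_ideal0.
- exact: monomial_idealD.
exact: monomial_idealX uG uv.
Qed.

Lemma linear_substX T u :
  linear_subst T 'X_[u] = \prod_j (\sum_i T i j *: 'X_i) ^+ u j.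
Proof.
by rewrite /linear_subst comp_mpolyX; apply: eq_bigr => j _; rewrite tnth_mktuple.
Qed.

Lemma linear_substE T p :
  linear_subst T p = \sum_(u <- msupp p) p@_u *: linear_subst T 'X_[u].
Proof. exact: comp_mpolyEX. Qed.

Lemma linear_substD T : {morph linear_subst T : p q / p + q}.
Proof. exact: comp_mpolyD. Qed.

Lemma linear_substM T : {morph linear_subst T : p q / p * q}.
Proof. by move=> p q; exact: rmorphM. Qed.

Lemma linear_substC T c : linear_subst T c%:MP = c%:MP.
Proof. exact: comp_mpolyC. Qed.

Lemma linear_subst1 p : linear_subst 1%:M p = p.
Proof.
rewrite linear_substE [RHS]mpolyE; apply: eq_bigr => u _; congr (_ *: _).
rewrite linear_substX [RHS]mpolyXE_id; apply: eq_bigr => j _; congr (_ ^+ _).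
rewrite (bigD1 j) //= mxE eqxx scale1r big1 ?addr0 // => i /negPf ij.
by rewrite mxE ij scale0r.
Qed.

Lemma linear_subst_comp T T' p :
  linear_subst T (linear_subst T' p) = linear_subst (T *m T') p.
Proof.
rewrite (linear_substE T') (linear_substE (T *m T')) [LHS]raddf_sum.
apply: eq_bigr => u _; rewrite [LHS]comp_mpolyZ; congr (_ *: _).
rewrite !linear_substX [LHS]rmorph_prod; apply: eq_bigr => j _.
rewrite [LHS]rmorphXn; congr (_ ^+ _); rewrite raddf_sum /=.
under eq_bigr => i _.
  rewrite comp_mpolyZ comp_mpolyXU -tnth_nth tnth_mktuple scaler_sumr.
  over.
rewrite exchange_big; apply: eq_bigr => k _; rewrite mxE scaler_suml.
by apply: eq_bigr => i _; rewrite scalerA mulrC.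
Qed.

(** Forward substitution: for i < j, the entry (i, j) of [L *m invmx L = 1] reduces to the product
    of the diagonal entry of [L] and the entry of the inverse, once the earlier rows of column j are
    known to vanish above the diagonal. *)
Lemma invmx_trig n (L : 'M[K]_n) :
  L \in unitmx -> is_trig_mx L -> is_trig_mx (invmx L).
Proof.
move=> uL trigL; have /is_trig_mxP tL := trigL; apply/is_trig_mxP.
have L_neq0 i : L i i != 0.
  move: uL; rewrite unitmxE (det_trig trigL) unitfE.
  by apply: contraNneq => Li0; rewrite (bigD1 i) //= Li0 mul0r.
suff H k (i j : 'I_n) : (i <= k)%N -> (i < j)%N -> invmx L i j = 0.
  by move=> i j; apply: H (leqnn i).
elim: k i j => [|k IHk] i j le_ik ij;
  have := congr1 (fun M : 'M_n => M i j) (mulmxV uL); rewrite !mxE;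
  rewrite -val_eqE /= ltn_eqF // (bigD1 i) //= big1 ?addr0;
  (try by move/eqP; rewrite mulf_eq0 (negPf (L_neq0 i)) => /eqP).
  move=> l li; rewrite tL ?mul0r //.
  by move: li le_ik; rewrite -val_eqE /=; lia.
move=> l li; case: (ltnP i l) => il; first by rewrite tL ?mul0r.
have lt_li : (l < i)%N by rewrite ltn_neqAle li.
by rewrite IHk ?mulr0 // ?(ltn_trans lt_li) // -ltnS (leq_trans lt_li).
Qed.

Lemma msupp_exp_le p u n :
  {in msupp p, forall v, borel_le v u} ->
  {in msupp (p ^+ n), forall v, borel_le v (u *+ n)%MM}.
Proof.
move=> pu; elim: n => [|n IHn] v.
  by rewrite expr0 msupp1 inE mulm0n => /eqP ->; exact: borel_le_refl.
rewrite exprS mulmS => /msuppM_le /allpairsP[[v1 v2] /= [s1 s2 ->]].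
by apply: borel_leD; [exact: pu | exact: IHn].
Qed.

(** Each factor x_j becomes a combination of the x_i with i <= j, and [borel_le] is compatible with
    products. *)
Lemma msupp_linear_subst_le T u :
  is_trig_mx T^T -> {in msupp (linear_subst T 'X_[u]), forall v, borel_le v u}.
Proof.
move=> /is_trig_mxP trigT; rewrite linear_substX => v.
rewrite [X in borel_le _ X]multinomUE_id.
elim/big_rec2: _ v => [|j w p _ IH] v.
  by rewrite msupp1 inE => /eqP ->; exact: borel_le_refl.
move=> /msuppM_le /allpairsP[[v1 v2] /= [s1 s2 ->]].
apply: borel_leD; last exact: IH.
move: v1 s1; apply: msupp_exp_le => x /msupp_sum_le /flattenP[s /mapP[i _ ->]].
case: (ltnP j i) => [ji|ij].
  by have := trigT _ _ ji; rewrite mxE => ->; rewrite scale0r msupp0.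
by move/msuppZ_le; rewrite msuppX inE => /eqP ->; exact: borel_le1.
Qed.

(** A monomial of the ideal is a multiple of some X^w with w in the closure, and the image of X^w is
    supported below w, hence in the closure. This gives one inclusion; the other one follows by
    applying it to the inverse substitution, which is triangular too. *)
Lemma borel_set_closure m : borel_set K (borel_closure m).
Proof.
pose G := borel_closure m.
have G_mdeg u : u \in G -> mdeg u = mdeg m.
  by rewrite in_borel_closure => /borel_leP[].
have stable T p : is_trig_mx T^T -> monomial_ideal G p ->
    monomial_ideal G (linear_subst T p).
  move=> trigT /monomial_idealP suppG; rewrite linear_substE big_seq.
  elim/big_ind: _ => [||u /suppG[w wG wu]].
  - exact: monomial_ideal0.
  - exact: monomial_idealD.
  apply/monomial_idealP => v /msuppZ_le.
  rewrite -(submK wu) mpolyXD linear_substM.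
  case/msuppM_le/allpairsP => -[v1 v2] /= [_ s2 ->].
  exists v2; last exact: lem_addl.
  move: wG; rewrite !in_borel_closure; apply: borel_le_trans.
  exact: (msupp_linear_subst_le trigT).
split=> [u v uG vG|T uT trigT q]; first by rewrite !G_mdeg.
split=> [Iq|[p Ip ->]]; last exact: stable.
exists (linear_subst (invmx T) q).
  by apply: stable => //; rewrite trmx_inv invmx_trig // unitmx_tr.
by rewrite linear_subst_comp mulmxV // linear_subst1.
Qed.

Hypothesis charK : [pchar K] =i pred0.

(* Substituting x_b + x_a for x_b in X^u produces X^(u - b + a) with the
   coefficient u_b, which is nonzero in characteristic 0. *)
Lemma borel_set_strongly_stable H : 
  borel_set K H -> strongly_stable (fun u => u \in H).
Proof.
move=> [eq_deg fixH] u a b uH ab ub.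
pose T : 'M[K]_d := 1%:M + delta_mx a b.
have TE i j : T i j = (i == j)%:R + ((i == a) && (j == b))%:R by rewrite !mxE.
have trigT : is_trig_mx T^T.
  apply/is_trig_mxP => i j ij; rewrite mxE TE -!val_eqE /= gtn_eqF //.
  by case: eqP => [ja|]; case: eqP => [ib|]; rewrite /= ?addr0 //; lia.
have uT : T \in unitmx.
  rewrite unitmxE -det_tr (det_trig trigT) big1 ?unitr1 // => i _.
  rewrite mxE TE eqxx; case: eqP => [->|]; rewrite ?addr0 //.
  by rewrite -val_eqE /= ltn_eqF ?addr0.
have Iu : monomial_ideal H ('X_[u] : {mpoly K[d]}).
  by rewrite -[X in _ X]scale1r; apply: monomial_idealX uH (lepm_refl _).
have /monomial_idealP : monomial_ideal H (linear_subst T 'X_[u]).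
  by apply/(fixH T uT trigT); exists 'X_[u].
pose v := (u - U_(b) + U_(a))%MM; have vu : mdeg v = mdeg u by exact: mdeg_swap.
have supp_v : v \in msupp (linear_subst T 'X_[u]).
  (* The substitution fixes all variables but x_b; [u'] is the part of [u] away from x_b. *)
  pose u' := (\sum_(j | j != b) U_(j) *+ u j)%MM.
  have uE : u = (u' + U_(b) *+ u b)%MM.
    by rewrite [LHS]multinomUE_id (bigD1 b) //= addmC.
  have vE : v = (u' + (U_(b) *+ (u b).-1 + U_(a)))%MM.
    by rewrite /v {1}uE -{1}(prednK ub) mulmSr !addmA addmK.
  have col j : \sum_i T i j *: 'X_i =
      if j == b then 'X_b + 'X_a else 'X_j :> {mpoly K[d]}.
    under eq_bigr do rewrite TE scalerDl.
    rewrite big_split (bigD1 j) //= eqxx scale1r big1 ?addr0; last first.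
      by move=> i /negPf ->; rewrite scale0r.
    rewrite (bigD1 a) //= eqxx /= big1 ?addr0; last first.
      by move=> i /negPf ->; rewrite scale0r.
    by case: eqP => [->|_]; rewrite ?scale1r // scale0r addr0.
  rewrite mcoeff_msupp linear_substX (bigD1 b) //= col eqxx.
  rewrite (eq_bigr (fun j => 'X_j ^+ u j)); last first.
    by move=> j /negPf jb; rewrite col jb.
  rewrite mprodXnE -/u' vE mcoeffMX exprDn raddf_sum /=.
  (* In the binomial expansion of (x_b + x_a)^(u_b), only the term linear in x_a contributes to the
     coefficient of [v]. *)
  have ub1 : (1 < (u b).+1)%N by [].
  rewrite (bigD1 (Ordinal ub1)) //= big1 ?addr0.
    rewrite bin1 mcoeffMn expr1 mpolyXn -mpolyXD mcoeffX subn1 eqxx.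
    by rewrite ((pcharf0P K).1 charK) -lt0n.
  move=> k /eqP k1; rewrite mcoeffMn !mpolyXn -mpolyXD mcoeffX.
  case: eqP => [/(congr1 (fun m : 'X_{1..d} => m a))|_]; last by rewrite mul0rn.
  rewrite !mnmDE !mulmnE !mnm1E eqxx (gtn_eqF ab : b == a = false).
  by rewrite !mul0n !mul1n => /= k_eq1; case: k1; apply: val_inj.
(* A generator dividing [v] has the same degree as [v], hence is [v] itself. *)
move=> /(_ v supp_v)[w wH wv].
rewrite -/v; suff <- : w = v by [].
have /eqP : (mdeg (v - w)%MM = 0)%N.
  apply: (@addIn (mdeg w)).
  by rewrite -mdegD submK // add0n vu; exact: eq_deg.
by rewrite mdeg_eq0 -{2}(submK wv) => /eqP ->; rewrite add0m.
Qed.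

Lemma borel_generated1P m G :
  borel_generated K [fset m] G <-> G = borel_closure m.
Proof.
have m_cl : m \in borel_closure m by rewrite in_borel_closure borel_le_refl.
have le_cl H : borel_set K H -> [fset m] `<=` H -> borel_closure m `<=` H.
  move=> /borel_set_strongly_stable sH; rewrite fsub1set => mH.
  apply/fsubsetP => u; rewrite in_borel_closure; exact: strongly_stable_le sH mH.
have cl_borel := borel_set_closure m.
split=> [[borelG mG minG]|->]; last by split; rewrite ?fsub1set.
apply/eqP; rewrite eqEfsubset le_cl // andbT.
by apply: minG; rewrite ?fsub1set.
Qed.

End BorelSets.

(** * Gauss monomials *)
Section Determinants.

Variables (R : comNzRingType) (n : nat).
Implicit Types A B : 'M[R]_n.

Lemma sum_row_cofactor A i k :
  \sum_j A k j * cofactor A i j = (k == i)%:R * \det A.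
Proof.
have /matrixP/(_ k i) := mul_mx_adj A; rewrite !mxE mulr_natl => <-.
by apply: eq_bigr => j _; rewrite mxE.
Qed.

Lemma sum_col_cofactor A j k :
  \sum_i A i k * cofactor A i j = (k == j)%:R * \det A.
Proof.
have /matrixP/(_ j k) := mul_adj_mx A; rewrite !mxE mulr_natl eq_sym => <-.
by apply: eq_bigr => i _; rewrite mxE mulrC.
Qed.

Lemma det_replace_row A B i :
  (forall k j, k != i -> B k j = A k j) ->
  \det B = \sum_j B i j * cofactor A i j.
Proof.
move=> eqBA; rewrite (expand_det_row B i); apply: eq_bigr => j _.
congr (_ * (_ * \det _)); apply/matrixP => k l; rewrite !mxE eqBA //.
by rewrite eq_sym neq_lift.
Qed.

Lemma det_neq0_perm A : \det A != 0 -> exists s : 'S_n, forall i, A i (s i) != 0.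
Proof.
move=> detA; have [s|all0] :=
  pickP (fun s : 'S_n => [forall i, A i (s i) != 0]).
  by move/forallP; exists s.
case/eqP: detA; rewrite /determinant big1 // => s _.
have /negbT := all0 s; rewrite negb_forall => /existsP[i /negPn/eqP Ai].
by rewrite (bigD1 i) //= Ai mul0r mulr0.
Qed.

End Determinants.

Section Tails.

Variable d : nat.
Implicit Types u v : 'X_{1..d}.

Lemma tail_inj u v : (forall k, tail k u = tail k v) -> u = v.
Proof.
by move=> eq_t; apply/mnmP => l; have := tailS u l; rewrite !eq_t tailS; lia.
Qed.



Lemma sum_ord_interval k p :
  (\sum_(l < d) ((p <= l) && (l < k)) = minn d k - p)%N.
Proof.
elim: d => [|n IHn]; first by rewrite big_ord0; lia.
by rewrite big_ord_recr /= IHn; case: (leqP p n); case: (ltnP n k) => /=; lia.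
Qed.

Lemma tail_all1 k : tail k [multinom 1%N | _ < d] = (d - k)%N.
Proof.
rewrite -[d in RHS]minnn -sum_ord_interval /tail big_mkcond.
by apply: eq_bigr => l _; rewrite mnmE ltn_ord andbT; case: leqP.
Qed.

End Tails.

(** * Stability of Gauss monomials under Borel moves *)

Section GaussMonomials.

Variable d : nat.
Implicit Types (u v w m : 'X_{1..d}) (G : {fset 'X_{1..d}}).

Lemma gauss_monomialE G u :
  gauss_monomial G u <->
  exists g : 'I_d -> 'X_{1..d},
    [/\ forall j, g j \in G, \det (\matrix_(j, l) (g j l)%:Z) != 0
      & (u + [multinom 1%N | _ < d] = \sum_j g j)%MM].
Proof.
split=> [[g [gG detg sumg]]|[g [gG detg sumg]]].
  exists (tnth g); split=> [j||]; first by rewrite gG ?mem_tnth.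
    by rewrite -det_tr; congr (\det _ != 0): detg; apply/matrixP => l j; rewrite !mxE.
  by rewrite sumg big_tuple.
exists [tuple g j | j < d]; split=> [v /mapP[j _ ->] //||].
  rewrite -det_tr; congr (\det _ != 0): detg.
  by apply/matrixP => l j; rewrite !mxE tnth_mktuple.
by rewrite sumg big_tuple; apply: eq_bigr => j _; rewrite tnth_mktuple.
Qed.

Lemma addmAC u v w : (u + v + w = u + w + v)%MM.
Proof. by rewrite -!addmA [(v + w)%MM]addmC. Qed.

(* Some column j with x_b | g_j can be replaced by x_a g_j / x_b without killing
   the determinant: this adds to it C_ja - C_jb, where C is the cofactor matrix,
   and if all these sums vanished, then pairing with the exponents of x_b would
   give sum_j g_j(b) = 1, contrary to x_b | u. *)
Lemma gauss_monomial_stable G :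
  strongly_stable (fun u => u \in G) -> strongly_stable (gauss_monomial G).
Proof.
move=> stG u a b /gauss_monomialE[g [gG detg sumg]] ab ub.
pose A : 'M[int]_d := \matrix_(j, l) (g j l)%:Z.
pose z j := cofactor A j a - cofactor A j b.
have sum_z : \sum_j (g j b)%:Z * z j = - \det A.
  have AE j : (g j b)%:Z = A j b by rewrite mxE.
  under eq_bigr do rewrite AE mulrBr.
  rewrite sumrB !sum_col_cofactor eqxx -val_eqE /= gtn_eqF //.
  by rewrite mul0r mul1r sub0r.
have sum_gb : (\sum_j g j b = u b + 1)%N.
  have := congr1 (fun v : 'X_{1..d} => v b) sumg.
  by rewrite mnm_sumE mnmDE mnmE.
have [j0 /andP[gj0 z_j0]|bad] :=
    pickP (fun j => (0 < g j b)%N && (\det A + z j != 0)); last first.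
  case/negP: detg; rewrite -/A.
  have : \sum_j (g j b)%:Z * z j = \sum_j (g j b)%:Z * - \det A.
    apply: eq_bigr => j _; have [->|gj] := posnP (g j b); first by rewrite !mul0r.
    have /negbT := bad j; rewrite gj /= negbK.
    by rewrite addrC addr_eq0 => /eqP ->.
  rewrite sum_z -mulr_suml -(big_morph Posz PoszD (erefl _)) sum_gb PoszD.
  rewrite mulrDl mul1r => /eqP; rewrite eq_sym -subr_eq0 addrK mulrN oppr_eq0.
  by rewrite mulf_eq0 => /orP[|//]; rewrite eqz_nat (gtn_eqF ub).
pose g' j := if j == j0 then (g j - U_(b) + U_(a))%MM else g j.
apply/gauss_monomialE; exists g'; split.
- by move=> j; rewrite /g'; case: eqP => // ->; exact: stG.
- rewrite (@det_replace_row _ _ A _ j0); last first.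
    by move=> k l /negPf kj; rewrite !mxE /g' kj.
  suff -> : \sum_l (\matrix_(j, l) (g' j l)%:Z) j0 l * cofactor A j0 l
     = \det A + z j0 by [].
  rewrite (expand_det_row A j0) /z.
  have pick c : cofactor A j0 c = \sum_l (c == l)%:Z * cofactor A j0 l.
    rewrite (bigD1 c) //= eqxx mul1r big1 ?addr0 // => l /negPf.
    by rewrite eq_sym => ->; rewrite mul0r.
  rewrite (pick a) (pick b) -sumrB -big_split; apply: eq_bigr => l _ /=.
  rewrite -mulrBl -mulrDl !mxE /g' eqxx; congr (_ * _); apply/eqP.
  rewrite addrA -subr_eq opprK -!PoszD -!mnm1E -!mnmDE.
  by rewrite [(_ + U_(b))%MM]mnm_swap.
rewrite (bigD1 j0) //= /g' eqxx (eq_bigr g); last by move=> j /negPf ->.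
apply: (@addIm _ U_(b)%MM).
rewrite addmAC mnm_swap // addmAC sumg (bigD1 j0) //=.
by rewrite [in RHS]addmAC mnm_swap // [in RHS]addmAC.
Qed.

End GaussMonomials.

(** * Upper bound on the tails of Gauss monomials *)

Section GaussBound.

Variable d : nat.
Implicit Types (u v m : 'X_{1..d}).

Lemma tailE k u : tail k u = (\sum_(l < d) (k <= l) * u l)%N.
Proof.
rewrite /tail big_mkcond; apply: eq_bigr => l _.
by case: leqP; rewrite ?mul1n ?mul0n.
Qed.

Lemma tail_eq_vanish u k p (l : 'I_d) :
  (tail p.+1 u <= tail k u)%N -> (p < l < k)%N -> u l = 0%N.
Proof.
move=> le_t /andP[pl lk]; have := tailS u l.
by have := leq_tail u pl; have := leq_tail u lk; lia.
Qed.

(* If t = tail k m, then the exponent vectors v with tail k v = t satisfy the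
   k - p independent linear equations v_l = 0 for p < l < k and
   (deg m) * tail k v = t * deg v, whose coefficient at v_p is - t. Hence at
   least k - p of the g_j have a smaller tail. *)
Lemma sum_tail_le m (g : 'I_d -> 'X_{1..d}) k p :
  (p < k < d)%N -> (0 < tail k m)%N -> tail p.+1 m = tail k m ->
  (forall j, borel_le (g j) m) -> \det (\matrix_(j, l) (g j l)%:Z) != 0 ->
  (\sum_j tail k (g j) + (k - p) <= tail k m * d)%N.
Proof.
move=> /andP[pk kd] t_gt0 tp gm detg.
have tg j : (tail k (g j) <= tail k m)%N by have /borel_leP[_] := gm j.
have lt_pd := ltn_trans pk kd; pose P := Ordinal lt_pd.
pose A : 'M[int]_d := \matrix_(l, j) (g j l)%:Z.
have detA : \det A != 0.
  by rewrite -det_tr; congr (\det _ != 0): detg; apply/matrixP => l j; rewrite !mxE.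
pose c l : int := (mdeg m * (k <= l))%N%:Z - (tail k m)%:Z.
(* The rows l of [A] with p < l < k already express the equations v_l = 0; row p is replaced by the
   equation on tail and degree, whose coefficients are [c]. *)
pose B : 'M[int]_d :=
  \matrix_(l, j) if l == P then \sum_(i < d) c i * A i j else A l j.
have detB : \det B = c P * \det A.
  rewrite (@det_replace_row _ _ A _ P); last by move=> l j /negPf lP; rewrite mxE lP.
  under eq_bigr do rewrite mxE eqxx mulr_suml.
  rewrite exchange_big (bigD1 P) //= [X in _ + X]big1 ?addr0.
    under eq_bigr do rewrite -mulrA.
    by rewrite -mulr_sumr sum_row_cofactor eqxx mul1r.
  move=> l /negPf lP; under eq_bigr do rewrite -mulrA.
  by rewrite -mulr_sumr sum_row_cofactor lP mul0r mulr0.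
have cP : c P != 0.
  by rewrite /c leqNgt pk muln0 sub0r oppr_eq0 eqz_nat -lt0n.
(* A nonzero Leibniz term assigns to the rows p, ..., k - 1 distinct columns j at which the equation
   of the row fails, so that [g j] has a smaller k-th tail than [m]. *)
have [s Bs] : exists s : 'S_d, forall l, B l (s l) != 0.
  by apply: det_neq0_perm; rewrite detB mulf_neq0.
pose J := [set j | tail k (g j) < tail k m]%N.
have sJ (l : 'I_d) : (p <= l < k)%N -> s l \in J.
  move=> /andP[pl lk]; rewrite inE ltn_neqAle tg andbT.
  apply: contraNneq (Bs l) => tj; rewrite mxE; case: (l =P P) => [_|lP].
    apply/eqP; have [dj _] := borel_leP _ _ (gm (s l)).
    transitivity ((mdeg m * tail k (g (s l)))%N%:Z
                  - (tail k m * mdeg (g (s l)))%N%:Z).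
      rewrite [mdeg (g _)]mdegE (tailE _ (g _)) !big_distrr /=.
      rewrite !(big_morph Posz PoszD (erefl (0 : int))) -sumrB.
      apply: eq_bigr => i _; rewrite mxE /c; case: (k <= i)%N; lia.
    by rewrite tj dj mulnC subrr.
  rewrite mxE (@tail_eq_vanish _ k p) //.
    by have [_ /(_ p.+1)] := borel_leP _ _ (gm (s l)); rewrite tp tj.
  rewrite lk andbT ltn_neqAle pl andbT.
  by apply/eqP => pl'; apply: lP; apply: val_inj.
have cardJ : (k - p <= #|J|)%N.
  have lt_d (x : 'I_(k - p)) : (p + x < d)%N by have := ltn_ord x; lia.
  pose f x := s (Ordinal (lt_d x)).
  have f_inj : injective f.
    by move=> x y /perm_inj /(congr1 val) /= /addnI; apply: val_inj.
  rewrite -[(k - p)%N]card_ord -(card_codom f_inj); apply: subset_leq_card.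
  by apply/subsetP => _ /codomP[x ->]; apply: sJ => /=; have := ltn_ord x; lia.
apply: leq_trans (_ : \sum_j tail k (g j) + #|J| <= _)%N; first by rewrite leq_add2l.
rewrite -sum1_card [X in (_ + X)%N]big_mkcond -big_split /= mulnC.
rewrite -[d in (d * _)%N]card_ord -sum_nat_const; apply: leq_sum => j _; rewrite inE.
by case: ltnP => [|_]; rewrite ?addn1 ?addn0 ?tg.
Qed.

End GaussBound.

(** * The monomial m' and its tails *)

Section GaussGenerator.

Variables (d r : nat) (i : 'I_r.+1 -> 'I_d) (a : 'I_r.+1 -> nat).
Hypothesis i_incr : {homo i : j k / (j < k)%N}.
Hypothesis i_last : (i ord_max).+1 = d.
Hypothesis a_gt0 : forall j, (0 < a j)%N.

Implicit Types (l : 'I_d) (j : 'I_r.+1) (k : nat).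

Local Notation m := (borel_gen i a).
Local Notation m' := (gauss_gen i a).

Lemma index_mono j j' : (i j <= i j')%N = (j <= j')%N.
Proof.
case: (ltngtP j j') => [/i_incr||/val_inj ->]; last exact: leqnn.
  exact: ltnW.
by move=> /i_incr; rewrite ltnNge => /negPf.
Qed.

Lemma le_last (l : 'I_d) : (l <= i ord_max)%N.
Proof. by have := ltn_ord l; lia. Qed.

Lemma borel_genE l : m l = (\sum_j (i j == l) * a j)%N.
Proof. by rewrite mnm_sumE; apply: eq_bigr => j _; rewrite mulmnE mnm1E. Qed.

Lemma borel_gen_gt0 j : (0 < m (i j))%N.
Proof. by rewrite borel_genE (bigD1 j) //= eqxx mul1n addn_gt0 a_gt0. Qed.

Lemma borel_gen_eq0 l : (forall j, i j != l) -> m l = 0%N.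
Proof. by move=> il; rewrite borel_genE big1 // => j _; rewrite (negPf (il j)). Qed.

(** With 0-based indices, the exponent of x_(i_j) in the denominator is at most i_j + 1 <= d,
    whereas a_j >= 1. *)
Lemma gauss_denom_le : (gauss_denom i <= m *+ d)%MM.
Proof.
apply/mnm_lepP => l; rewrite mulmnE borel_genE mnm_sumE big_distrl /=.
apply: leq_sum => j _; rewrite mulmnE mnm1E -mulnA leq_mul2l; apply/orP; right.
apply: leq_trans (leq_pmull d (a_gt0 j)).
by have := ltn_ord (i j); case: eqP => [->|_]; lia.
Qed.

(** The successor of [l] among the i_j, the last index being its own successor. Minimizing j amounts
    to minimizing i_j, since [i] is increasing. *)
Definition next_index (l : 'I_d) : 'I_d :=
  if (l < i ord_max)%N then i [arg min_(j < ord_max | (l < i j)%N) j] else l.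

Lemma next_index_le l j : (l < i j)%N -> (next_index l <= i j)%N.
Proof.
rewrite /next_index => lj.
have -> : (l < i ord_max)%N by apply: leq_trans lj _; exact: le_last.
case: arg_minnP => [|k _ /(_ j lj)]; last by rewrite index_mono.
by apply: leq_trans lj _; exact: le_last.
Qed.

Lemma next_indexP l : (l < i ord_max)%N ->
  exists2 j, next_index l = i j & (l < i j)%N.
Proof. by rewrite /next_index => /[dup] ll ->; case: arg_minnP => // j; exists j. Qed.

Lemma next_index_last l : (l < i ord_max)%N = false -> next_index l = l.
Proof. by rewrite /next_index => ->. Qed.

Lemma next_index_gt0 l : (0 < m (next_index l))%N.
Proof.
case: (boolP (l < i ord_max)%N) => [/next_indexP[j -> _]|ll].
  exact: borel_gen_gt0.
rewrite next_index_last; last exact/negbTE.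
suff -> : l = i ord_max by exact: borel_gen_gt0.
by apply: val_inj; have := le_last l; move: ll => /=; lia.
Qed.

(** The empty maximum 0 matches the convention of [prev_index] when no i_j lies below [k]. *)
Definition last_before k := (\max_(j | i j < k) i j)%N.

Lemma lt_last_before k : (0 < k)%N -> (last_before k < k)%N.
Proof.
by move=> k0; rewrite /last_before; elim/big_ind: _ => // x y; rewrite gtn_max => -> ->.
Qed.

Lemma last_before_ge k j : (i j < k)%N -> (i j <= last_before k)%N.
Proof. by move=> ijk; rewrite /last_before (bigD1 j) //= leq_maxl. Qed.

(** No variable strictly between [last_before k] and [k] divides m. *)
Lemma tail_last_before k : (0 < k)%N -> tail (last_before k).+1 m = tail k m.
Proof.
move=> k0; rewrite /tail [RHS]big_mkcond [LHS]big_mkcond; apply: eq_bigr => l _.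
case: (leqP k l) => [kl|lk].
  by rewrite (leq_trans (lt_last_before k0) kl).
case: ltnP => // pl; apply: borel_gen_eq0 => j; apply/eqP => il.
by have := @last_before_ge k j; rewrite il lk leqNgt pl => /(_ isT).
Qed.

(** Identifies the l for which replacing x_(next_index l) by x_l lowers the k-th tail. There are k -
    last_before k of them, exactly the loss required by [sum_tail_le]. *)
Lemma cross_next_index k l : (0 < k < d)%N ->
  (l < k <= next_index l)%N = (last_before k <= l < k)%N.
Proof.
move=> /andP[k0 kd]; case: (ltnP l k) => lk /=; last by rewrite andbF.
rewrite andbT; have ll : (l < i ord_max)%N by lia.
have [j nl lj] := next_indexP ll; rewrite nl; case: (leqP k (i j)) => [kj|jk].
  apply/esym/bigmax_leqP => j' ij'; rewrite leqNgt; apply/negP => lj'.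
  by have := next_index_le lj'; rewrite nl; lia.
by apply/esym/negbTE; rewrite -ltnNge (leq_trans lj) // last_before_ge.
Qed.

(** The differences i_j - i_(j-1) over the i_j >= k telescope to d - 1 - last_before k, and the
    extra unit at the last j supplies the missing 1. *)
Lemma tail_gauss_denom k :
  (k < d)%N -> (tail k (gauss_denom i) + last_before k = d)%N.
Proof.
move=> kd; have k_last : (k <= i ord_max)%N by lia.
have [j0 kj0 min_j0] := @arg_minnP _ _ (fun j : 'I_r.+1 => (k <= i j)%N) val k_last.
have le_k j : (k <= i j)%N = (j0 <= j)%N.
  apply/idP/idP => [/min_j0 //|]; rewrite -index_mono; exact: leq_trans.
have last_j0 : last_before k = prev_index i j0.
  apply/eqP; rewrite eqn_leq; apply/andP; split.
    apply/bigmax_leqP => j; rewrite ltnNge le_k -ltnNge /prev_index.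
    case: (j0 : nat) (ltn_ord j0) => // n nr jn.
    by rewrite index_mono inordK // ltnW.
  rewrite /prev_index; case j0n: (nat_of_ord j0) (ltn_ord j0) => [|n] // nr.
  by apply: last_before_ge; rewrite ltnNge le_k j0n inordK ?ltnn // ltnW.
(* [prev_index] extended to natural numbers, so that i_j is [f j.+1] and the sum telescopes. *)
pose f n := if n is k.+1 then i (inord k) : nat else 0%N.
have prevE j : prev_index i j = f j by [].
have fS (j : 'I_r.+1) : f j.+1 = i j by rewrite /= inord_val.
have f_le n : (n < r.+1)%N -> (f n <= f n.+1)%N.
  by case: n => //= n nr; rewrite index_mono !inordK // ltnW.
have -> : tail k (gauss_denom i) =
    (\sum_(j < r.+1 | j0 <= j) ((f j.+1 - f j) + (j == ord_max)))%N.
  rewrite tail_sum [RHS]big_mkcond; apply: eq_bigr => j _.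
  by rewrite tailMn tail1 le_k prevE -fS; case: leqP; rewrite ?mul1n ?mul0n.
rewrite big_split /= -(big_geq_mkord j0 r.+1 xpredT (fun n => f n.+1 - f n)%N).
rewrite telescope_sumn_in; last 2 first.
- exact: ltnW.
- by move=> n /andP[_ /f_le].
rewrite (bigD1 ord_max) /=; last by rewrite -ltnS.
rewrite big1 => [|j /andP[_ /negPf ->] //].
have -> : inord r = ord_max :> 'I_r.+1 by apply: val_inj; rewrite /= inordK.
rewrite last_j0 prevE eqxx addn0 addnAC subnK ?addn1 //.
rewrite /f; case: (j0 : nat) => // n; exact: le_last.
Qed.

Lemma tail_gauss_gen k :
  (k < d)%N -> (tail k m' + d = tail k m * d + last_before k)%N.
Proof.
move=> kd; have := tail_gauss_denom kd.
have : (tail k m' + tail k (gauss_denom i) = tail k m * d)%N.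
  by rewrite -tailD submK ?tailMn // gauss_denom_le.
lia.
Qed.

Lemma mdeg_gauss_gen : (mdeg m' + d = mdeg m * d)%N.
Proof.
rewrite -!tail0 tail_gauss_gen; last by rewrite -i_last.
by rewrite /last_before big_pred0 ?addn0.
Qed.

End GaussGenerator.

(** * Gauss monomials of a principal Borel set *)

Section GaussSet.

Variables (d r : nat) (i : 'I_r.+1 -> 'I_d) (a : 'I_r.+1 -> nat).
Hypothesis i_incr : {homo i : j k / (j < k)%N}.
Hypothesis i_last : (i ord_max).+1 = d.
Hypothesis a_gt0 : forall j, (0 < a j)%N.

Local Notation m := (borel_gen i a).
Local Notation m' := (gauss_gen i a).

(* The witness for m': g_l = x_l m / x_n(l), where n(l) is the least of the i_j
   above l, except that g_(d-1) = m. *)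
Let g (l : 'I_d) : 'X_{1..d} := (m - U_(next_index i l) + U_(l))%MM.

Let g_next l : (g l + U_(next_index i l) = m + U_(l))%MM.
Proof. by rewrite mnm_swap // next_index_gt0. Qed.

(** A vector c orthogonal to all g_l defines a linear form phi with c_(next l) = phi(m) + c_l. At
    the last index, its own successor, this gives phi(m) = 0; hence c is constant along successors,
    and phi(m) = c * deg m forces c = 0. *)
Let det_g : \det (\matrix_(j, l) (g j l)%:Z) != 0.
Proof.
set A := \matrix_(j, l) _.
suff : \det (map_mx (intr : int -> rat) A^T) != 0.
  by rewrite det_map_mx det_tr intr_eq0.
apply/det0P => -[c c_neq0 cA0].
pose phi (u : 'X_{1..d}) : rat := \sum_l c 0 l * (u l)%:R.
have phiD u v : phi (u + v)%MM = phi u + phi v.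
  by rewrite -big_split; apply: eq_bigr => l _; rewrite mnmDE natrD mulrDr.
have phi1 l : phi U_(l)%MM = c 0 l.
  rewrite /phi (bigD1 l) //= mnm1E eqxx mulr1 big1 ?addr0 // => l' /negPf ll'.
  by rewrite mnm1E eq_sym ll' mulr0.
have phi_g j : phi (g j) = 0.
  have /matrixP/(_ 0 j) := cA0; rewrite !mxE => <-.
  by apply: eq_bigr => l _; rewrite !mxE.
have c_next l : c 0 (next_index i l) = phi m + c 0 l.
  by have := congr1 phi (g_next l); rewrite (phiD (g l)) (phiD m) !phi1 phi_g add0r.
have phi_m : phi m = 0.
  have := c_next (i ord_max); rewrite next_index_last ?ltnn // => /eqP.
  by rewrite -subr_eq0 opprD addrCA subrr addr0 oppr_eq0 => /eqP.
have c_cst l : c 0 l = c 0 (i ord_max).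
  have [n] := ubnP (d - l)%N; elim: n l => // n IHn l le_n.
  case: (ltnP l (i ord_max)) => ll; last first.
    by congr (c 0 _); apply: val_inj => /=; have := le_last i_last l; lia.
  have := c_next l; rewrite phi_m add0r => <-; apply: IHn.
  have [j -> lj] := next_indexP ll.
  by have := ltn_ord (i j); lia.
case/eqP: c_neq0; apply/rowP => l; rewrite mxE c_cst.
move/eqP: phi_m; rewrite /phi.
under eq_bigr do rewrite c_cst.
rewrite -mulr_sumr mulf_eq0 => /orP[/eqP //|].
rewrite -natr_sum pnatr_eq0 (bigD1 (i ord_max)) //= addn_eq0.
by rewrite (gtn_eqF (borel_gen_gt0 i a_gt0 ord_max)).
Qed.

(** The two sides are compared through their tails: passing from m to g_l lowers the k-th tail for
    the l given by [cross_next_index], and summing over l yields the value in [tail_gauss_gen]. *)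
Lemma gauss_gen_monomial : gauss_monomial (borel_closure m) m'.
Proof.
have ord0d : (0 < d)%N by rewrite -i_last.
apply/gauss_monomialE; exists g; split=> [l||]; last 2 first.
- exact: det_g.
- apply: tail_inj => k; rewrite tailD tail_all1 tail_sum.
  have sum_g : (\sum_l tail k (g l) + \sum_l (k <= next_index i l)
      = tail k m * d + \sum_(l < d) (k <= l))%N.
    rewrite -big_split mulnC -[d in (d * _)%N]card_ord -sum_nat_const -big_split.
    apply: eq_bigr => l _ /=.
    by rewrite -tail1 -[in RHS]tail1 -!tailD g_next.
  case: (posnP k) => [k0|k_gt0].
    have : (\sum_l (k <= next_index i l) = \sum_(l < d) (k <= l))%N.
      by apply: eq_bigr => l _; rewrite k0.
    have := mdeg_gauss_gen i_incr i_last a_gt0.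
    by move: sum_g; rewrite k0 !(tail0 m') !(tail0 m) subn0; lia.
  case: (ltnP k d) => [kd|dk]; last first.
    rewrite tail_ge // big1 ?addn0 => [|l _]; last exact: tail_ge.
    lia.
  have := tail_gauss_gen i_incr i_last a_gt0 kd.
  have : (\sum_l (k <= next_index i l)
      = \sum_(l < d) (k <= l) + \sum_(l < d) (last_before i k <= l < k))%N.
    rewrite -big_split; apply: eq_bigr => l _ /=.
    rewrite -(cross_next_index i_incr i_last) ?k_gt0 //.
    have : (l <= next_index i l)%N.
      case: (boolP (l < i ord_max)%N) => [/next_indexP[j -> /ltnW] //|/negbTE ll].
      by rewrite next_index_last.
    by case: (leqP k l); case: (leqP k (next_index i l)) => //=; lia.
  rewrite sum_ord_interval (minn_idPr (ltnW kd)).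
  by have := lt_last_before i k_gt0; move: sum_g; lia.
rewrite in_borel_closure /g.
case: (boolP (l < i ord_max)%N) => [/[dup] ll /next_indexP[j nl lj]|/negbTE ll].
  by apply: borel_le_swap; rewrite ?next_index_gt0 // nl.
rewrite next_index_last // submK ?borel_le_refl // lep1mP -lt0n.
by have := next_index_gt0 i_last a_gt0 l; rewrite next_index_last.
Qed.

(** For 0 < k < d, the bound of [sum_tail_le] with p = last_before k is exactly the k-th tail of m'
    times x_1 ... x_d. *)
Lemma gauss_monomial_borel_le u :
  gauss_monomial (borel_closure m) u -> borel_le u m'.
Proof.
move=> /gauss_monomialE[h [hG deth sumh]].
have hm j : borel_le (h j) m by rewrite -in_borel_closure.
have sum_t k : (tail k u + (d - k) = \sum_j tail k (h j))%N.
  by rewrite -tail_all1 -tailD sumh tail_sum.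
have deg_u : mdeg u = mdeg m'.
  have := mdeg_gauss_gen i_incr i_last a_gt0; have := sum_t 0%N.
  rewrite !tail0 subn0 (eq_bigr (fun=> mdeg m)) => [|j _].
    by rewrite sum_nat_const card_ord; lia.
  by rewrite tail0; have /borel_leP[] := hm j.
apply/borel_leP; split=> // k; case: (posnP k) => [->|k_gt0].
  by rewrite !tail0 deg_u.
case: (ltnP k d) => [kd|dk]; last by rewrite tail_ge.
have pk := lt_last_before i k_gt0.
have t_gt0 : (0 < tail k m)%N.
  rewrite /tail (bigD1 (i ord_max)) /=; last by lia.
  by rewrite addn_gt0 borel_gen_gt0.
have pkd : (last_before i k < k < d)%N by rewrite pk.
have := sum_tail_le pkd t_gt0 (tail_last_before i a k_gt0) hm deth.
have := tail_gauss_gen i_incr i_last a_gt0 kd.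
by rewrite -sum_t; lia.
Qed.

Lemma gauss_monomialP u :
  u \in borel_closure m' <-> gauss_monomial (borel_closure m) u.
Proof.
rewrite in_borel_closure; split; last exact: gauss_monomial_borel_le.
apply: strongly_stable_le gauss_gen_monomial.
by apply: gauss_monomial_stable; exact: strongly_stable_closure.
Qed.

End GaussSet.

(** * The Gauss algebra *)
Section GaussAlgebra.

Variables (K : fieldType) (d : nat).
Hypothesis charK : [pchar K] =i pred0.
Implicit Types (p q : {mpoly K[d]}) (u : 'X_{1..d}) (G : {fset 'X_{1..d}}).

Lemma gen_algebra_min (X Y : {mpoly K[d]} -> Prop) :
  (forall p, X p -> gen_algebra Y p) ->
  forall p, gen_algebra X p -> gen_algebra Y p.
Proof.
move=> XY p; elim=> {p} [p /XY //|c|p q _ Yp _ Yq|p q _ Yp _ Yq].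
- exact: gen_algebra_const.
- exact: gen_algebra_add.
exact: gen_algebra_mul.
Qed.

Lemma pchar0_intr_eq0 (z : int) : ((z%:~R : K) == 0) = (z == 0).
Proof.
have natr_eq0 := (pcharf0P K).1 charK.
case: z => n; first by rewrite -pmulrn natr_eq0.
by rewrite NegzE mulrNz oppr_eq0 -pmulrn natr_eq0.
Qed.

Lemma det_natr_eq0 n (e : 'I_n -> 'I_n -> nat) :
  (\det (\matrix_(j, l) (e j l)%:R : 'M[K]_n) == 0)
  = (\det (\matrix_(j, l) (e j l)%:Z) == 0).
Proof.
rewrite -pchar0_intr_eq0 -det_map_mx; congr (\det _ == 0).
by apply/matrixP => j l; rewrite !mxE /= -pmulrn.
Qed.

(** In the Leibniz term of s, differentiating by x_(s j) extracts an exponent and divides by x_(s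
    j); the product of these divisors is x_1 ... x_d for every s, so the monomial factors out. *)
Lemma det_jacobian_monomials (e : 'I_d -> 'X_{1..d}) :
  \det (\matrix_(j, l) ('X_[e j])^`M(l)) =
  \det (\matrix_(j, l) (e j l)%:R) *:
    'X_[\sum_j e j - [multinom 1%N | _ < d]] :> {mpoly K[d]}.
Proof.
rewrite /determinant scaler_suml; apply: eq_bigr => s _.
suff prodE : \prod_j (\matrix_(j, l) ('X_[e j])^`M(l)) j (s j) =
    (\prod_j (\matrix_(j, l) (e j l)%:R : 'M_d) j (s j)) *:
      'X_[\sum_j e j - [multinom 1%N | _ < d]] :> {mpoly K[d]}.
  by rewrite prodE; case: (odd_perm s); rewrite ?expr1 ?expr0 ?mulN1r ?mul1r ?scaleNr.
under eq_bigr do rewrite mxE mderivX.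
under [in RHS]eq_bigr do rewrite mxE.
(* Truncated quotients are genuine once the coefficient is nonzero, as then x_(s j) divides X^(e j)
   for all j. *)
rewrite scaler_prod; have [->|prod_neq0] := eqVneq (\prod_j (e j (s j))%:R) (0 : K).
  by rewrite !scale0r.
have es j : (U_(s j) <= e j)%MM.
  rewrite lep1mP; apply: contraNneq prod_neq0 => ej.
  by rewrite (bigD1 j) //= ej mul0r.
have sum_s : (\sum_j U_(s j) = [multinom 1%N | _ < d])%MM.
  apply/mnmP => l; rewrite mnm_sumE mnmE (bigD1 (s^-1%g l)) //= permKV mnm1E eqxx.
  rewrite big1 // => j /negPf; rewrite -(inj_eq (@perm_inj _ s)) permKV.
  by rewrite mnm1E => ->.
rewrite mprodXE -sum_s; congr (_ *: 'X_[_]).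
apply: (@addIm _ (\sum_j U_(s j))%MM); rewrite submK; last first.
  apply/mnm_lepP => l; rewrite !mnm_sumE; apply: leq_sum => j _.
  exact/mnm_lepP.
by rewrite -big_split; apply: eq_bigr => j _; rewrite /= submK.
Qed.

(** Minors in [gauss_algebra] use increasing row choices, whereas the factors of a Gauss monomial
    come in any order. *)
Lemma sorting_perm n k (f : 'I_k -> 'I_n) : injective f ->
  exists s : 'S_k, {homo f \o s : i j / (i < j)%N}.
Proof.
move=> f_inj; pose t := [tuple val (f i) | i < k].
have perm_t : perm_eq (sort leq t) t by rewrite perm_sort.
have /tuple_permP[s ts] := perm_t; exists s.
have fs (i : 'I_k) : f (s i) = nth 0%N (sort leq t) i :> nat.
  by rewrite ts (nth_map i) ?size_enum_ord // nth_ord_enum !tnth_mktuple.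
have uniq_t : uniq t.
  by rewrite map_inj_uniq ?enum_uniq // => i j /val_inj /f_inj.
have sort_t : sorted ltn (sort leq t).
  by rewrite ltn_sorted_uniq_leq sort_uniq uniq_t sort_sorted //; exact: leq_total.
move=> i j ij /=; rewrite !fs; apply: (sorted_ltn_nth ltn_trans) => //;
  by rewrite inE size_sort size_tuple.
Qed.

Lemma gauss_algebraE G G' :
  (forall u, u \in G' <-> gauss_monomial G u) ->
  forall p, gauss_algebra (monomials K G) p <-> monomial_algebra G' p.
Proof.
move=> G'P p; pose s := enum_fset G.
have size_s : size (monomials K G) = size s by rewrite size_map.
have minorE (f : 'I_d -> 'I_(size (monomials K G))) :
    \det (rowsub f (jacobian_mx (monomials K G))) =
    \det (\matrix_(j, l) (nth 0%MM s (f j) l)%:R) *: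
      'X_[\sum_j nth 0%MM s (f j) - [multinom 1%N | _ < d]].
  rewrite -det_jacobian_monomials; congr (\det _); apply/matrixP => j l.
  by rewrite !mxE (nth_map 0%MM) // -size_s ltn_ord.
split; apply: gen_algebra_min => {}p.
  move=> [f _ ->]; rewrite minorE; set e := fun j => nth 0%MM s (f j).
  have [->|det_neq0] := eqVneq (\det (\matrix_(j, l) (e j l)%:R)) (0 : K).
    by rewrite scale0r -mpolyC0; exact: gen_algebra_const.
  rewrite -mul_mpolyC; apply: gen_algebra_mul; first exact: gen_algebra_const.
  apply: gen_algebra_gen; eexists; last reflexivity.
  apply/G'P/gauss_monomialE; exists e; split.
  - by move=> j; rewrite /e mem_nth // -size_s ltn_ord.
  - by rewrite -det_natr_eq0.
  (* x_1 ... x_d divides the product: a nonzero Leibniz term yields, for each l, a factor divisible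
     by x_l. *)
  rewrite submK //; apply/mnm_lepP => l; rewrite mnmE mnm_sumE.
  have [t et] := det_neq0_perm det_neq0.
  rewrite (bigD1 (t^-1%g l)) //= addn_gt0 lt0n; apply/orP; left.
  by have := et (t^-1%g l); rewrite mxE permKV; apply: contraNneq => ->.
move=> [u /G'P/gauss_monomialE[e [eG det_neq0 sum_e]] ->].
(* Repeated factors would give equal rows, so the factors are distinct generators and their
   positions can be sorted. *)
have e_inj : injective e.
  move=> j k ejk; apply/eqP; apply: contraNT det_neq0 => jk.
  by apply/eqP; apply: (determinant_alternate jk) => l; rewrite !mxE ejk.
have e_lt j : (index (e j) s < size (monomials K G))%N.
  by rewrite size_s index_mem eG.
pose f j := Ordinal (e_lt j).
have ef j : nth 0%MM s (f j) = e j by rewrite nth_index // eG.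
have f_inj : injective f by move=> j k fjk; apply: e_inj; rewrite -!ef fjk.
have [t t_mono] := sorting_perm f_inj.
pose c : K := \det (\matrix_(j, l) (e (t j) l)%:R).
have c_neq0 : c != 0.
  have -> : c = \det (row_perm t (\matrix_(j, l) (e j l)%:R)).
    by congr (\det _); apply/matrixP => j l; rewrite !mxE.
  by rewrite row_permE det_mulmx mulf_neq0 ?det_natr_eq0 // det_perm signr_eq0.
have -> : 'X_[u] = c^-1%:MP * \det (rowsub (f \o t) (jacobian_mx (monomials K G))).
  rewrite minorE mul_mpolyC.
  have -> : (\sum_j nth 0%MM s ((f \o t) j) = u + [multinom 1%N | _ < d])%MM.
    rewrite sum_e [RHS](reindex_inj (@perm_inj _ t)) /=.
    by apply: eq_bigr => j _; rewrite ef.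
  rewrite addmK scalerA -[LHS]scale1r; congr (_ *: _).
  rewrite -[LHS](mulVf c_neq0); congr (_ * \det _); apply/matrixP => j l.
  by rewrite !mxE -ef.
apply: gen_algebra_mul; first exact: gen_algebra_const.
by apply: gen_algebra_gen; exists (f \o t).
Qed.

End GaussAlgebra.

(** * Krull dimension *)
Section KrullDimension.

Variables (K : fieldType) (d : nat).
Implicit Types (p q : {mpoly K[d]}) (u v m : 'X_{1..d}).

Lemma msupp_prod_exp_le n (y : 'I_n -> {mpoly K[d]}) (e : 'I_n -> nat) D v l :
  (forall j, (msize (y j) <= D)%N) ->
  v \in msupp (\prod_j y j ^+ e j) -> (v l <= \sum_j D * e j)%N.
Proof.
move=> yD; elim/big_rec2: _ v => [|j b p _ IH] v.
  by rewrite msupp1 inE => /eqP ->; rewrite mnm0E.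
move=> /msuppM_le /allpairsP[[v1 v2] /= [s1 s2 ->]]; rewrite mnmDE leq_add ?IH //.
elim: (e j) v1 s1 => [|k IHk] w.
  by rewrite expr0 msupp1 inE => /eqP ->; rewrite mnm0E.
rewrite exprS mulnS => /msuppM_le /allpairsP[[w1 w2] /= [t1 t2 ->]].
rewrite mnmDE leq_add ?IHk //; apply: leq_trans (yD j).
apply: leq_trans (ltnW (msize_mdeg_lt t1)); rewrite mdegE (bigD1 l) //=.
exact: leq_addr.
Qed.

(* The N^n monomials in the y_j with exponents below N only involve (CN)^d
   monomials in the variables, and (CN)^d < N^n when n > d and N > C^d. *)
Lemma algebraically_dependent n (y : 'I_n -> {mpoly K[d]}) : (d < n)%N ->
  exists (N : nat) (c : {ffun 'I_n -> 'I_N} -> K),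
    (exists e, c e != 0) /\ \sum_e c e *: \prod_j y j ^+ e j = 0.
Proof.
move=> dn; pose D := (\max_j msize (y j))%N.
have yD j : (msize (y j) <= D)%N by exact: (leq_bigmax (F := fun j => msize (y j))).
(* A product of the [y j] with exponents below N has all its exponents at most n * D * N < M. *)
pose C := (n * D + 1)%N; pose N := (C ^ d + 1)%N; pose M := (C * N)%N.
exists N; pose E : finType := {ffun 'I_n -> 'I_N}.
pose F : finType := {ffun 'I_d -> 'I_M}.
pose mon (b : F) := [multinom (b l : nat) | l < d].
pose B : 'M[K]_(#|E|, #|F|) :=
  \matrix_(x, z) (\prod_j y j ^+ (enum_val x : E) j)@_(mon (enum_val z)).
have cardEF : (#|F| < #|E|)%N.
  rewrite !card_ffun !card_ord /M expnMn.
  apply: (@leq_trans (N * N ^ d)); last by rewrite -expnS leq_pexp2l // /N addn1.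
  by rewrite ltn_mul2r expn_gt0 /N addn1 ltnSn.
(* [B] has more rows, the products of the [y j], than columns, the monomials in the variables; a
   kernel vector is a relation. *)
have : kermx B != 0.
  rewrite kermx_eq0; apply: contraL cardEF; rewrite -leqNgt => /eqP <-.
  exact: rank_leq_col.
case/rowV0Pn => w /sub_kermxP wB w_neq0.
exists (fun e => w 0 (enum_rank e)); split.
  case/rV0Pn: w_neq0 => x wx; exists (enum_val x).
  by rewrite enum_valK.
apply/mpolyP => v; rewrite mcoeff0 raddf_sum /=.
under eq_bigr do rewrite mcoeffZ.
have [/forallP lt_v|] := boolP [forall l, v l < M]%N; last first.
  rewrite negb_forall => /existsP[l vl]; rewrite big1 // => e _.
  rewrite (memN_msupp_eq0 (m := v)) ?mulr0 //.
  apply: contra vl => /(msupp_prod_exp_le l yD) le_v.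
  apply: leq_ltn_trans le_v _; apply: (@leq_ltn_trans (\sum_(j < n) D * N)%N).
    by apply: leq_sum => j _; rewrite leq_mul2l (ltnW (ltn_ord _)) orbT.
  rewrite sum_nat_const card_ord mulnA /M ltn_mul2r /C addn1 ltnSn.
  by rewrite /N addn1.
pose b : F := [ffun l => Ordinal (lt_v l)].
have vE : v = mon b by apply/mnmP => l; rewrite mnmE ffunE.
have /matrixP/(_ 0 (enum_rank b)) := wB; rewrite !mxE => sum0.
rewrite -[RHS]sum0 [RHS](reindex (@enum_rank E)) /=.
  by apply: eq_bigr => e _; rewrite mxE !enum_rankK vE.
exact: onW_bij (enum_rank_bij _).
Qed.

(** * Prime chains in a subalgebra of the polynomial ring *)

Section PrimeChain.

Variables (X : {mpoly K[d]} -> Prop).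
Local Notation A := (gen_algebra X).

Lemma gen_algebraZ c p : A p -> A (c *: p).
Proof.
move=> Ap; rewrite -mul_mpolyC; apply: gen_algebra_mul => //.
exact: gen_algebra_const.
Qed.

Lemma gen_algebra_exp p e : A p -> A (p ^+ e).
Proof.
move=> Ap; elim: e => [|e IH].
  by rewrite expr0 -mpolyC1; exact: gen_algebra_const.
by rewrite exprS; exact: gen_algebra_mul.
Qed.

Lemma prime_idealB P p q : prime_ideal_of A P -> P p -> P q -> P (p - q).
Proof.
move=> [_ [_ PD] PM _ _] Pp Pq; apply: PD => //.
rewrite -mulN1r -mpolyC1 -mpolyCN; apply: PM => //; exact: gen_algebra_const.
Qed.

Lemma prime_ideal_sum P (I : Type) (s : seq I) (Q : pred I) (F : I -> {mpoly K[d]}) :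
  prime_ideal_of A P -> (forall x, Q x -> P (F x)) -> P (\sum_(x <- s | Q x) F x).
Proof. by move=> [_ [P0 PD] _ _ _] PF; elim/big_ind: _. Qed.

Lemma prime_ideal_exp P p e : prime_ideal_of A P -> A p -> ~ P p -> ~ P (p ^+ e).
Proof.
move=> [_ _ _ P1 PP] Ap nPp; elim: e => [|e IH]; first by rewrite expr0.
by rewrite exprS => /PP[] //; exact: gen_algebra_exp.
Qed.

(* A vanishing combination of monomials in the y_j, with y_j in P_(j+1) but not
   in P_j, is reduced modulo P_1, P_2, ... in turn: after the lowest power of
   y_j has been divided out, only the terms with that exponent of y_j survive
   modulo P_(j+1). In the end a single nonzero constant is left. *)
Lemma prime_chain_independent n (P : nat -> {mpoly K[d]} -> Prop)
    (y : 'I_n -> {mpoly K[d]}) N (c : {ffun 'I_n -> 'I_N} -> K) :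
  (forall k, (k <= n)%N -> prime_ideal_of A (P k)) ->
  (forall k p, (k < n)%N -> P k p -> P k.+1 p) ->
  (forall j : 'I_n, P j.+1 (y j)) -> (forall j : 'I_n, ~ P j (y j)) ->
  (exists e, c e != 0) -> \sum_e c e *: \prod_j y j ^+ e j <> 0.
Proof.
move=> primeP subP Py nPy [e0 ce0] sum0.
have Ay j : A (y j).
  by have [PA _ _ _ _] := primeP j.+1 (ltn_ord j); exact: PA.
(* Generalized for the passage from k to k + 1: [J] collects the exponent vectors still present,
   which are determined by their entries from k on. *)
suff main k (J : {set {ffun 'I_n -> 'I_N}}) : (k <= n)%N -> J != set0 ->
    (forall e, e \in J -> c e != 0) ->
    {in J &, forall e e' : {ffun 'I_n -> 'I_N},
      (forall j : 'I_n, (k <= j)%N -> e j = e' j) -> e = e'} ->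
    ~ P k (\sum_(e in J) c e *: \prod_(j < n | (k <= j)%N) y j ^+ e j).
  apply: (main 0%N [set e | c e != 0]) => //.
  - by apply/set0Pn; exists e0; rewrite inE.
  - by move=> e; rewrite inE.
  - by move=> e e' _ _ eq_e; apply/ffunP => j; apply: eq_e.
  have [_ [P0 _] _ _ _] := primeP 0%N (leq0n n).
  rewrite (_ : \sum_(e in _) _ = 0) // -[RHS]sum0 big_mkcond.
  by apply: eq_bigr => e _; rewrite inE; case: eqP => [->|_]; rewrite ?scale0r.
have [b] := ubnP (n - k)%N; elim: b k J => // b IHb k J le_b kn /set0Pn[e1 Je1] cJ injJ.
(* At k = n, [J] is a singleton and the sum is a nonzero constant, which no proper ideal
   contains. *)
have [kn'|nk] := ltnP k n; last first.
  have kE : k = n by apply/eqP; rewrite eqn_leq kn.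
  have JE e : e \in J = (e == e1).
    apply/idP/eqP => [Je|-> //]; apply: injJ => // j.
    by rewrite leqNgt kE ltn_ord.
  rewrite kE (big_pred1 e1) // big_pred0 => [|j]; last by rewrite leqNgt ltn_ord.
  have [_ _ PM P1 _] := primeP n (leqnn n) => Pc; apply: P1.
  rewrite -(scale1r 1) -(mulVf (cJ _ Je1)) -scalerA -mul_mpolyC.
  by apply: PM => //; exact: gen_algebra_const.
pose j0 := Ordinal kn'; have [e2 Je2 min_e2] :=
  @arg_minnP _ _ (mem J) (fun e : {ffun 'I_n -> 'I_N} => val (e j0)) Je1.
have primek := primeP _ kn; have primek1 := primeP _ kn'.
pose rest (e : {ffun 'I_n -> 'I_N}) := \prod_(j < n | (k.+1 <= j)%N) y j ^+ e j.
have Arest e : A (rest e).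
  rewrite /rest; elim/big_ind: _ => [|p q|j _].
  - by rewrite -mpolyC1; exact: gen_algebra_const.
  - exact: gen_algebra_mul.
  - exact: gen_algebra_exp.
pose t e := c e *: (y j0 ^+ (e j0 - e2 j0) * rest e).
have At e : A (t e).
  apply: gen_algebraZ; apply: gen_algebra_mul => //; exact: gen_algebra_exp.
have -> : \sum_(e in J) c e *: \prod_(j < n | (k <= j)%N) y j ^+ e j =
    y j0 ^+ e2 j0 * \sum_(e in J) t e.
  rewrite mulr_sumr; apply: eq_bigr => e Je; rewrite -scalerAr mulrA -exprD.
  rewrite subnKC; last exact: min_e2.
  rewrite (bigD1 j0) //=; congr (_ *: (_ * _)); apply: eq_bigl => j.
  by rewrite ltn_neqAle andbC eq_sym.
have [_ _ _ _ primek_mul] := primek.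
(* Since [y j0] is not in the prime P_k, neither is its power, so the cofactor lies in P_k and thus
   in P_(k+1). *)
move=> /primek_mul[||Pye|].
- exact: gen_algebra_exp.
- elim/big_ind: _ => // [|p q]; last exact: gen_algebra_add.
  by rewrite -mpolyC0; exact: gen_algebra_const.
- exact: (prime_ideal_exp primek (Ay j0) (nPy j0) Pye).
move=> /(subP _ _ kn').
rewrite (bigID (fun e : {ffun 'I_n -> 'I_N} => e j0 == e2 j0)) /=.
set S1 := \sum_(e in J | _) _; set S2 := \sum_(e in J | _) _ => PS.
have PS2 : P k.+1 S2.
  apply: prime_ideal_sum => // e /andP[Je ne].
  have lt_e : (e2 j0 < e j0)%N.
    by rewrite ltn_neqAle eq_sym ne; exact: min_e2.
  have [_ _ PM _ _] := primek1.
  have -> : t e = c e *: (y j0 ^+ (e j0 - e2 j0).-1 * rest e) * y j0.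
    rewrite /t -{1}(prednK (_ : 0 < e j0 - e2 j0)%N) ?subn_gt0 // exprS.
    by rewrite -scalerAl [in RHS]mulrC mulrA.
  apply: PM (Py j0); apply: gen_algebraZ; apply: gen_algebra_mul => //.
  exact: gen_algebra_exp.
have : P k.+1 S1 by rewrite -[S1](addrK S2); apply: prime_idealB.
have -> : S1 = \sum_(e in [set e in J | e j0 == e2 j0])
                 c e *: \prod_(j < n | (k.+1 <= j)%N) y j ^+ e j.
  apply: eq_big => [e|e /andP[_ /eqP ee]]; first by rewrite inE.
  by rewrite /t ee subnn expr0 mul1r.
apply: IHb => //.
- by lia.
- by apply/set0Pn; exists e2; rewrite inE eqxx andbT.
- by move=> e; rewrite inE => /andP[/cJ].
move=> e e'; rewrite !inE => /andP[Je /eqP ee] /andP[Je' /eqP ee'] eq_e.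
apply: injJ => // j; rewrite leq_eqVlt => /orP[/eqP kj|]; last exact: eq_e.
by rewrite (_ : j = j0) ?ee ?ee' //; apply: val_inj.
Qed.

Lemma krull_dim_le n : prime_chain A n -> (n <= d)%N.
Proof.
move=> [P [primeP chainP]]; rewrite leqNgt; apply/negP => dn.
have [y yP] : exists y : 'I_n -> {mpoly K[d]},
    forall j : 'I_n, P j.+1 (y j) /\ ~ P j (y j).
  apply: (fin_all_exists (P := fun (j : 'I_n) p => P j.+1 p /\ ~ P j p)) => j.
  by have [_ [p Pp nPp]] := chainP j (ltn_ord j); exists p.
have [N [c [c_neq0 sum0]]] := algebraically_dependent y dn.
apply: (prime_chain_independent primeP _ _ _ c_neq0 sum0) => [k p kn|j|j].
- by have [sub _] := chainP k kn; exact: sub.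
- by have [] := yP j.
- by have [] := yP j.
Qed.

(** The substitution killing the last k variables; its kernel is the ideal that they generate. *)
Let trunc_mx k : 'M[K]_d := diag_mx (\row_l (l < d - k)%:R).

Let linear_subst_trunc k u :
  linear_subst (trunc_mx k) 'X_[u] =
  if [forall l : 'I_d, (d - k <= l)%N ==> (u l == 0%N)] then 'X_[u] else 0.
Proof.
have colE j : \sum_i trunc_mx k i j *: 'X_i = (j < d - k)%:R *: 'X_j :> {mpoly K[d]}.
  rewrite (bigD1 j) //= big1 ?addr0 => [|i ij].
    by rewrite !mxE eqxx.
  by rewrite !mxE (negPf ij) scale0r.
rewrite linear_substX; case: ifPn => [/forallP u0|].
  rewrite [RHS]mpolyXE_id; apply: eq_bigr => j _; rewrite colE.
  case: ltnP => [_|/(implyP (u0 j))/eqP ->]; first by rewrite scale1r.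
  by rewrite !expr0.
rewrite negb_forall => /existsP[j]; rewrite negb_imply => /andP[kj uj].
by rewrite (bigD1 j) //= colE ltnNge kj scale0r expr0n (negPf uj) mul0r.
Qed.

(* The chain consists of the contractions to A of the ideals generated by the
   last k variables. *)
Lemma prime_chain_dim m (z : 'I_d) : z.+1 = d -> (0 < m z)%N ->
  (forall u, borel_le u m -> A 'X_[u]) -> prime_chain A d.
Proof.
move=> zd mz Am; exists (fun k p => A p /\ linear_subst (trunc_mx k) p = 0).
split=> k kd.
  split=> [p []//||b p Ab [Ap p0]|[_]|p q Ap Aq [_]].
  - split.
      rewrite -mpolyC0; split; last exact: linear_substC.
      exact: gen_algebra_const.
    move=> p q [Ap p0] [Aq q0]; split; first exact: gen_algebra_add.
    by rewrite linear_substD p0 add0r.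
  - split; first exact: gen_algebra_mul.
    by rewrite linear_substM p0 mulr0.
  - by rewrite -mpolyC1 linear_substC mpolyC1 => /eqP; rewrite oner_eq0.
  rewrite linear_substM => /eqP; rewrite mulf_eq0.
  by case/orP => /eqP ?; [left|right].
split=> [p [Ap p0]|].
  split=> //; have -> : trunc_mx k.+1 = trunc_mx k.+1 *m trunc_mx k.
    rewrite mulmx_diag; congr diag_mx; apply/rowP => l; rewrite !mxE -natrM mulnb.
    by congr (nat_of_bool _)%:R; lia.
  by rewrite -linear_subst_comp p0 -mpolyC0 linear_substC.
have lt_x : (d - k.+1 < d)%N by lia.
(* x is the variable killed at stage k + 1 but not at stage k. The monomial u, x times a power of
   the first variable, has positive tails at most 1, so it lies below m because the last variable
   divides m. *)
pose x := Ordinal lt_x; have lt_o : (0 < d)%N by lia.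
pose o := Ordinal lt_o; pose u := (U_(o) *+ (mdeg m).-1 + U_(x))%MM.
have m_gt0 : (0 < mdeg m)%N by rewrite mdegE (bigD1 z) //= addn_gt0 mz.
have Au : A 'X_[u].
  apply: Am; apply/borel_leP; split=> [|l].
    by rewrite mdegD mdegMn !mdeg1 mul1n addn1 prednK.
  rewrite tailD tailMn !tail1; case: l => [|l] /=.
    by rewrite tail0 mul1n addn1 prednK.
  rewrite mul0n add0n; case: leqP => // lx.
  rewrite /tail (bigD1 z) /=; last by lia.
  by rewrite addn_gt0 mz.
exists 'X_[u] => [|[_]]; rewrite linear_subst_trunc.
  split=> //; case: forallP => // /(_ x); rewrite leqnn /= => /eqP.
  by rewrite mnmDE mnm1E eqxx addn1.
case: forallP => [_ /eqP|[] l].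
  by rewrite -msupp_eq0 msuppX.
apply/implyP => kl; rewrite mnmDE mulmnE !mnm1E -!val_eqE /=.
have -> : (0 == l :> nat) = false by lia.
by rewrite mul0n add0n eqb0; lia.
Qed.

End PrimeChain.

End KrullDimension.

(** * The Gauss algebra of a principal Borel-fixed algebra *)

Theorem theorem2p4 (K : fieldType) (charK : [pchar K] =i pred0)
    (d r : nat) (i : 'I_r.+1 -> 'I_d) (a : 'I_r.+1 -> nat)
    (i_incr : {homo i : j k / (j < k)%N})
    (i_last : (i ord_max).+1 = d)
    (a_gt0 : forall j, (0 < a j)%N)
    (G : {fset 'X_{1..d}}) (A : {mpoly K[d]} -> Prop)
    (A_borel : principal_borel_fixed (borel_gen i a) G A) :
  let m := borel_gen i a in
  let m' := gauss_gen i a in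
  let GA := gauss_algebra (monomials K G) in
  (gauss_denom i <= m *+ d)%MM /\
  exists G' : {fset 'X_{1..d}},
    [/\ borel_generated K [fset m'] G',
        forall u : 'X_{1..d}, u \in G' <-> gauss_monomial G u,
        forall p : {mpoly K[d]}, GA p <-> monomial_algebra G' p
      & (0 < m' (i ord_max))%N -> principal_borel_fixed m' G' GA].
Proof.
move=> m m' GA; split; first exact: gauss_denom_le.
have [/(borel_generated1P charK) GE _ _] := A_borel.
have G'_gen : borel_generated K [fset m'] (borel_closure m').
  exact/borel_generated1P.
have G'P u : u \in borel_closure m' <-> gauss_monomial G u.
  by rewrite GE; exact: gauss_monomialP.
have GAE p : GA p <-> monomial_algebra (borel_closure m') p.
  exact: gauss_algebraE.
exists (borel_closure m'); split=> // m'_last; split=> //.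
(* Divisibility of m' by x_d yields the chain of length d. *)
split; last by move=> k; exact: krull_dim_le.
apply: (prime_chain_dim i_last m'_last) => u um'.
by apply/GAE/gen_algebra_gen; exists u; rewrite ?in_borel_closure.
Qed.
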